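(* Let $E$ be a non-empty set of integers. Then there exists a list of disjoint symmetric integer intervals $\{S_{m_j,N_j}\}_j$ ($m_j\in\mathbb{Z}$, $N_j\in\mathbb{N}$) which satisfies $$E=\bigcup_j S_{m_j,N_j}\qquad\text{and}\qquad 4S_{m_j,N_j}\cap E^c\neq\varnothing .$$
   Context: $\mathbb{N}=\{0,1,2,\dots\}$. For $m\in\mathbb{Z}$, $N\in\mathbb{N}$, the symmetric integer interval with center $m$ is $S_{m,N}:=\{k\in\mathbb{Z}:|k-m|\le N\}$. Dilation by a positive integer $\lambda$ is $\lambda S_{m,N}:=\{k\in\mathbb{Z}:|k-m|\le\lambda N\}$, and for a single-point set ($N=0$, $S_{m,0}=\{m\}$) it is $\lambda\{m\}:=\{m-(\lambda-1),\dots,m,\dots,m+(\lambda-1)\}$. $E^c=\mathbb{Z}\setminus E$ is the complement of $E$.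
   Formalization: The set E is additionally assumed to be different from the set of all integers: for E = ℤ the complement is empty, so no 4S can meet it, while a non-empty list is needed to cover E. *)

(* Defs.v *)
From mathcomp Require Import all_boot all_order all_algebra.
From mathcomp Require Import classical_sets.

Set Implicit Arguments.
Unset Strict Implicit.
Unset Printing Implicit Defensive.

Import Order.TTheory GRing.Theory Num.Theory.

Local Open Scope classical_set_scope.
Local Open Scope ring_scope.

Definition symint (m : int) (N : nat) : set int :=
  [set k : int | `|k - m| <= N%:Z].

(* The dilate lam S_{m,N}, for a positive integer lam.  A symmetric interval
   determines its center and radius, so the dilation is given on (m, N). *)
Definition dilate (lam : nat) (m : int) (N : nat) : set int :=
  if N is 0%N then [set k : int | `|k - m| <= lam%:Z - 1]
  else [set k : int | `|k - m| <= (lam * N)%N%:Z].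

(* Index sets of finite (possibly empty) and of infinite lists. *)
Definition list_index (J : set nat) : Prop :=
  J = [set: nat] \/ exists n : nat, J = [set j : nat | (j < n)%N].

(* Main.v *)
Require Import Defs.
From HB Require Import structures.
From mathcomp Require Import all_boot all_order all_algebra zify.
From mathcomp Require Import boolp classical_sets functions cardinality.

Set Implicit Arguments.
Unset Strict Implicit.
Unset Printing Implicit Defensive.

Import Order.TTheory GRing.Theory Num.Theory.

Local Open Scope classical_set_scope.
Local Open Scope ring_scope.

(** Every maximal block of consecutive elements of [E] is adjacent to a point
    outside [E].  A finite block of odd length is itself a symmetric interval,
    and one of even length is a symmetric interval followed by a singleton.
    An infinite block adjacent to [a] is cut into consecutive intervals of
    lengths 1, 3, 9, ..., starting next to [a]: the one of length [3 ^ i] has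
    center at distance [3 ^ i] from [a] and radius [(3 ^ i - 1) / 2], so its
    dilate by 4 contains [a]. *)

(* A decomposition of [D] is encoded by the map sending a point of [D] to the
   center and radius of the piece that contains it. *)
Definition decomposes (E D : set int) (g : int -> int * nat) : Prop :=
  forall x, D x ->
    [/\ symint (g x).1 (g x).2 x,
        symint (g x).1 (g x).2 `<=` D,
        dilate 4 (g x).1 (g x).2 `&` ~` E !=set0 &
        forall y, symint (g x).1 (g x).2 y -> g y = g x].

(** [maxn 3 (4 * N)] merges the two clauses of [dilate 4]: radius 3 for a single point, [4 * N]
    otherwise. *)
Lemma dilate4_meets (E : set int) (m : int) (N : nat) (a : int) :
  ~ E a -> `|a - m| <= (maxn 3 (4 * N))%:Z -> dilate 4 m N `&` ~` E !=set0.
Proof.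
by move=> Ea am; exists a; split=> //; case: N am => [|N]; rewrite /dilate /=; lia.
Qed.

Lemma decomposes_finite (E : set int) (a b : int) :
  ~ E a -> ~ E b -> exists g, decomposes E [set y | a < y < b] g.
Proof.
move=> Ea Eb.
have [ab|ab] := leP b (a + 1).
  by exists (fun=> (0, 0%N)) => x /= ?; exfalso; lia.
(* The block has [b - a - 1] points, which is [2 * N + 1] or [2 * N + 2]. *)
pose N := (`|b - a|.-2)./2%N.
have [par|par] : b - a = (2 * N + 2)%N \/ b - a = (2 * N + 3)%N by lia.
- exists (fun=> (a + N%:Z + 1, N)) => x /= xab; split=> //.
  + by rewrite /symint /=; lia.
  + by move=> y; rewrite /symint /=; lia.
  + by apply: (dilate4_meets Ea) => /=; lia.
- exists (fun x => if x == b - 1 then (b - 1, 0%N) else (a + N%:Z + 1, N)).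
  move=> x /= xab; case: eqP => xb /=.
  + split.
    * by rewrite /symint /=; lia.
    * by move=> y; rewrite /symint /=; lia.
    * by exists b; split=> //=; lia.
    * by move=> y; rewrite /symint /= => yb; case: eqP => //; lia.
  + split.
    * by rewrite /symint /=; lia.
    * by move=> y; rewrite /symint /=; lia.
    * by apply: (dilate4_meets Ea) => /=; lia.
    * by move=> y; rewrite /symint /= => yb; case: eqP => //; lia.
Qed.

Lemma decomposes_ray (E : set int) (s a : int) :
  s = 1 \/ s = - 1 -> ~ E a -> exists g, decomposes E [set y | 0 < s * (y - a)] g.
Proof.
move=> s1 Ea.
(* The piece of length [3 ^ i] covers the distances d from [a] with
   [3 ^ i + 1 <= 2 * d <= 3 ^ i.+1 - 1], so i is the integer part of the base-3 logarithm of
   [2 * d - 1]. *)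
pose l x := trunc_log 3 (`|x - a| * 2 - 1)%N.
pose g x := let k := (3 ^ l x)%N in (a + s * k%:Z, k./2).
exists g => x /= xa.
have odd3 i : (3 ^ i = 2 * (3 ^ i)./2 + 1)%N.
  by rewrite -[LHS]odd_double_half oddX orbT mul2n addnC.
have kx : (3 ^ l x <= `|x - a| * 2 - 1 < 3 * 3 ^ l x)%N.
  by rewrite -expnS; apply: trunc_log_bounds => //; case: s1 xa => ->; lia.
have := odd3 (l x); rewrite {}/g /=.
move: kx; set k := (3 ^ l x)%N; set h := k./2 => kx kh; split.
- by rewrite /symint /=; case: s1 xa => ->; lia.
- by move=> y; rewrite /symint /=; case: s1 xa => ->; lia.
(* The distance from [a] to the center is [k = 2 * h + 1], at most 3 if [h = 0] and at most [4 * h]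
   otherwise. *)
- by apply: (dilate4_meets Ea) => /=; case: s1 xa => ->; lia.
- move=> y; rewrite /symint /= => yk.
  suff -> : l y = l x by [].
  apply: trunc_log_eq => //; rewrite expnS -/k.
  by case: s1 xa yk => ->; lia.
Qed.

Lemma nearest_not_in (E : set int) (s x : int) : s = 1 \/ s = - 1 -> E x ->
  (exists2 d : nat, ~ E (x + s * d%:Z) &
     forall i : nat, (i < d)%N -> E (x + s * i%:Z)) \/
  (forall i : nat, E (x + s * i%:Z)).
Proof.
move=> s1 Ex.
have [allE|/existsNP ex] := pselect (forall i : nat, E (x + s * i%:Z)).
  by right.
left; have {}ex : exists d : nat, ~~ `[< E (x + s * d%:Z) >].
  by case: ex => d Ed; exists d; apply/asboolPn.
case: (ex_minnP ex) => d /asboolPn Ed dmin; exists d => // i id.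
by apply: contrapT => /asboolPn /dmin; rewrite leqNgt id.
Qed.

(** The maximal block of [E] around [x]; [Num.min] and [Num.max] allow [y] on either side of [x]. *)
Definition component (E : set int) (x : int) : set int :=
  [set y | forall z, Num.min x y <= z <= Num.max x y -> E z].

Lemma component_refl (E : set int) (x : int) : E x -> component E x x.
Proof. by move=> Ex z xz; have -> : z = x by lia. Qed.

Lemma component_sub (E : set int) (x : int) : component E x `<=` E.
Proof. by move=> y; apply; lia. Qed.

(** The segment between two integers is covered by the segments joining each of them to a third. *)
Lemma component_eq (E : set int) (x y : int) :
  component E x y -> component E y = component E x.
Proof.
move=> xy; apply/seteqP; split=> w yw z zw.
- have [] : (Num.min x y <= z <= Num.max x y) \/
    (Num.min y w <= z <= Num.max y w) by lia.
  + exact: xy.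
  + exact: yw.
- have [] : (Num.min x y <= z <= Num.max x y) \/
    (Num.min x w <= z <= Num.max x w) by lia.
  + exact: xy.
  + exact: yw.
Qed.

Lemma decomposes_component (E : set int) (x : int) :
  E <> [set: int] -> E x -> exists g, decomposes E (component E x) g.
Proof.
move=> ET Ex.
(* Gaps on both sides of [x] give a finite block, a gap on one side only gives a ray, and no gap
   would make [E] all of the integers. *)
have [[p Ep ltp]|allp] := nearest_not_in (or_introl erefl) Ex;
have [[n En ltn]|alln] := nearest_not_in (or_intror erefl) Ex.
- suff -> : component E x = [set y | x + - 1 * n%:Z < y < x + 1 * p%:Z].
    exact: decomposes_finite.
  apply/seteqP; split=> y /=.
  + move=> xy; have [yp|yp] := leP (x + 1 * p%:Z) y.
      by case: Ep; apply: xy; lia.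
    have [yn|yn] := leP y (x + - 1 * n%:Z); last by lia.
    by case: En; apply: xy; lia.
  + move=> ynp z xyz; have [zx|zx] := leP z x.
      have -> : z = x + - 1 * `|z - x|%N%:Z by lia.
      (* If [y] is not below [x], then [z = x] and the bound on [y] does not yield [0 < n]; [Ex]
         settles this case. *)
      have [->|z0] := eqVneq z x; first by rewrite subrr mulr0 addr0.
      by apply: ltn; lia.
    have -> : z = x + 1 * `|z - x|%N%:Z by lia.
    by apply: ltp; lia.
- suff -> : component E x = [set y | 0 < - 1 * (y - (x + 1 * p%:Z))].
    by apply: decomposes_ray => //; right.
  apply/seteqP; split=> y /=.
  + move=> xy; have [yp|yp] := leP (x + 1 * p%:Z) y; last by lia.
    by case: Ep; apply: xy; lia.
  + move=> yp z xyz; have [zx|zx] := leP z x.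
      by have -> : z = x + - 1 * `|z - x|%N%:Z by lia.
    have -> : z = x + 1 * `|z - x|%N%:Z by lia.
    by apply: ltp; lia.
- suff -> : component E x = [set y | 0 < 1 * (y - (x + - 1 * n%:Z))].
    by apply: decomposes_ray => //; left.
  apply/seteqP; split=> y /=.
  + move=> xy; have [yn|yn] := leP y (x + - 1 * n%:Z); last by lia.
    by case: En; apply: xy; lia.
  + move=> yn z xyz; have [zx|zx] := leP x z.
      by have -> : z = x + 1 * `|z - x|%N%:Z by lia.
    have -> : z = x + - 1 * `|z - x|%N%:Z by lia.
    by apply: ltn; lia.
- case: ET; apply/seteqP; split=> // z _; have [zx|zx] := leP x z.
    by have -> : z = x + 1 * `|z - x|%N%:Z by lia.
  by have -> : z = x + - 1 * `|z - x|%N%:Z by lia.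
Qed.

Lemma decomposes_proper (E : set int) :
  E <> [set: int] -> exists g, decomposes E E g.
Proof.
move=> ET.
(* Choosing the map as a function of the component, not of the point, makes
   the choices agree on each component. *)
have /choice[G GP] (D : set int) : exists g,
    (exists g', decomposes E D g') -> decomposes E D g.
  have [[g gD]|nog] := pselect (exists g, decomposes E D g); first by exists g.
  by exists (fun=> (0, 0%N)) => /nog.
exists (fun x => G (component E x) x) => x Ex.
have [xg sub meets const] :=
  GP _ (decomposes_component ET Ex) x (component_refl Ex).
split=> // [y /sub|y yg]; first exact: component_sub.
(* The piece of [x] stays in its component, so [y] is given the same map [G (component E x)]. *)
by rewrite (component_eq (sub y yg)) const.
Qed.

HB.instance Definition _ := isPointed.Build int 0.

Lemma countable_enum (T : pointedType) (A : set T) : countable A ->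
  exists (J : set nat) (f : nat -> T), list_index J /\ set_bij J A f.
Proof.
move=> cA; have [/finite_setP[n An]|Ainf] := pselect (finite_set A).
- have /card_set_bijP[f fP] := card_esym An.
  by exists `I_n, f; split=> //; right; exists n.
- have /card_esym/card_set_bijP[f fP] := eq_card_nat cA Ainf.
  by exists [set: nat], f; split=> //; left.
Qed.

Theorem lemma4p5 (E : set int) (E_nonempty : E !=set0)
    (E_proper : E <> [set: int]) :
  exists (J : set nat) (m : nat -> int) (N : nat -> nat),
    [/\ list_index J,
        trivIset J (fun j => symint (m j) (N j)),
        E = \bigcup_(j in J) symint (m j) (N j) &
        forall j, J j -> dilate 4 (m j) (N j) `&` ~` E !=set0].
Proof.
have [g gE] := decomposes_proper E_proper.
(* Enumerating the values of [g] rather than the points of [E] lists each piece once. *)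
have [J [f [Jlist [fJ finj fsurj]]]] :=
  @countable_enum (int * nat)%type (g @` E) (countableP _).
exists J, (fun j => (f j).1), (fun j => (f j).2); split=> //.
- move=> i j Ji Jj [z []].
  have [[x Ex gx] [y Ey gy]] := (fJ i Ji, fJ j Jj).
  rewrite -gx -gy => zi zj.
  (* A common point [z] of two pieces forces both to be [g z], and injectivity of [f] gives
     [i = j]. *)
  have [_ _ _ /(_ z zi) gzx] := gE x Ex; have [_ _ _ /(_ z zj) gzy] := gE y Ey.
  by apply: finj; rewrite ?inE // -gx -gy -gzx -gzy.
- apply/seteqP; split=> [x Ex|x [j Jj]].
  + have [j Jj fj] := fsurj (g x) (ex_intro2 _ _ x Ex erefl).
    by exists j => //=; rewrite fj; case: (gE x Ex).
  + by have [y Ey <-] := fJ j Jj; case: (gE y Ey) => _ + _ _; apply.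
- by move=> j Jj; have [y Ey <-] := fJ j Jj; case: (gE y Ey).
Qed.
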